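(* Let $n\ge 1$ and let the Schur norm of a matrix $M\in\mathbb{M}_n(\mathbb{C})$ be $\|M\|_{\mathrm{S}}=\max\{\|M\circ C\|: C\in\mathbb{M}_n(\mathbb{C}),\ \|C\|=1\}$, where $\|\cdot\|$ is the operator norm and $\circ$ the entrywise product. Call a matrix $C$ with $\|C\|\le 1$ a witness for $\|M\|_{\mathrm{S}}$ if $\|M\circ C\|=\|M\|_{\mathrm{S}}$. Then: (1) If $M\in\mathbb{M}_n(\mathbb{R})$, there is a real witness for $\|M\|_{\mathrm{S}}$. (2) If $M\in\mathbb{M}_n(\mathbb{R})$, there is a real orthogonal witness for $\|M\|_{\mathrm{S}}$. (3) If $M\in\mathbb{M}_n(\mathbb{C})$, there is a unitary witness for $\|M\|_{\mathrm{S}}$.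
   Context: $\mathbb{M}_n(\mathbb{C})$ and $\mathbb{M}_n(\mathbb{R})$ denote the $n\times n$ complex and real matrices; $\|C\|$ is the operator norm induced by the Euclidean norm. $M\circ C$ is the entrywise (Schur/Hadamard) product. *)

(* Defs.v *)
From HB Require Import structures.
From mathcomp Require Import all_boot all_order all_algebra.
From mathcomp Require Import spectral.
From mathcomp Require Import boolp classical_sets reals.
From mathcomp Require Import complex.

Set Implicit Arguments.
Unset Strict Implicit.
Unset Printing Implicit Defensive.

Import Order.TTheory GRing.Theory Num.Theory.
Local Open Scope classical_set_scope.
Local Open Scope ring_scope.
Local Open Scope complex_scope.

(* Norms take values in R; the modulus is Normc.normc : R[i] -> R, since the
   norm of R[i] as a numDomainType takes its values in R[i]. *)
Definition euclidean_norm (R : realType) (n : nat) (v : 'cV[R[i]]_n) : R :=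
  Num.sqrt (\sum_(i < n) Normc.normc (v i 0) ^+ 2).

Definition operator_norm (R : realType) (n : nat) (A : 'M[R[i]]_n) : R :=
  sup [set r | exists2 v : 'cV[R[i]]_n,
    euclidean_norm v <= 1 & r = euclidean_norm (A *m v)].

Definition schur_product (T : pzRingType) (n : nat) (M C : 'M[T]_n) : 'M[T]_n :=
  map2_mx *%R M C.

Definition schur_values (R : realType) (n : nat) (M : 'M[R[i]]_n) : set R :=
  [set r | exists2 C : 'M[R[i]]_n,
    operator_norm C = 1 & r = operator_norm (schur_product M C)].

(* The greatest element of schur_values M. It exists for 0 < n (the unit sphere
   of a finite-dimensional space is compact); the default 0 is used only for
   n = 0. *)
Definition schur_norm (R : realType) (n : nat) (M : 'M[R[i]]_n) : R :=
  xget 0 (schur_values M `&` ubound (schur_values M)).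

Definition schur_witness (R : realType) (n : nat) (M C : 'M[R[i]]_n) : Prop :=
  operator_norm C <= 1 /\ operator_norm (schur_product M C) = schur_norm M.

Definition complex_mx (R : realType) (n : nat) (A : 'M[R]_n) : 'M[R[i]]_n :=
  map_mx (real_complex R) A.

Definition orthogonal_mx (R : realType) (n : nat) (A : 'M[R]_n) : Prop :=
  A *m A^T = 1%:M.

(* Main.v *)
(** The pairs [(A, x)], with [A] a contraction and [x] in the unit ball, form a
    compact set.  Since [A |-> |(M o A) x|^2] is convex, a maximizer [(U, x)] whose
    Frobenius norm is largest among all maximizers has the property that
    [U + E] and [U - E] are both contractions only for [E = 0].  This forces [U]
    to be unitary: with [P = 1 - U* U] and [Q = 1 - U U*], the perturbation
    [E = U P / 3] first gives [U P = 0], and then small multiples of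
    [E = Q X P], for [X] arbitrary, give [Q X P = 0], so [P = 0] or [Q = 0].
    All the perturbations are real when [U] is, so the argument applies equally
    to real pairs.  When [M] is real, the maximum over real pairs equals the one
    over complex pairs: multiplying [A] by unimodular diagonal matrices makes
    [x] and [(M o A) x] nonnegative, and [A] can then be replaced by its
    entrywise real part. *)

Require Import Defs.
From mathcomp Require Import all_boot all_order all_algebra.
From mathcomp Require Import sesquilinear spectral reals complex.
From mathcomp Require Import boolp classical_sets topology normedtype derive.
From mathcomp Require Import ring lra.

Set Implicit Arguments.
Unset Strict Implicit.
Unset Printing Implicit Defensive.

Import Order.TTheory GRing.Theory Num.Theory Num.Def Normc.
Import numFieldNormedType.Exports.
Local Open Scope classical_set_scope.
Local Open Scope ring_scope.
Local Open Scope complex_scope.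
Local Open Scope sesquilinear_scope.

(** * Squared norms and real inner products of complex vectors *)

Section Norm.
Context {R : realType}.
Local Notation C := R[i].

Lemma normc_ge0 (z : C) : 0 <= normc z.
Proof. by case: z => a b; exact: sqrtr_ge0. Qed.

Lemma normc_sq (z : C) : normc z ^+ 2 = complex.Re z ^+ 2 + complex.Im z ^+ 2.
Proof. by case: z => a b /=; rewrite sqr_sqrtr// addr_ge0 ?sqr_ge0. Qed.

Lemma complex_ReM (z w : C) : complex.Re (z * w)
  = complex.Re z * complex.Re w - complex.Im z * complex.Im w.
Proof. by case: z => a b; case: w. Qed.

Lemma complex_ImM (z w : C) : complex.Im (z * w)
  = complex.Re z * complex.Im w + complex.Im z * complex.Re w.
Proof. by case: z => a b; case: w. Qed.

Lemma Re_conjM (z : C) : complex.Re (z^* * z)%C = normc z ^+ 2.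
Proof. by rewrite normc_sq; case: z => a b /=; lra. Qed.

Definition sqnorm n (v : 'cV[C]_n) : R := \sum_(i < n) normc (v i 0) ^+ 2.

(** The Euclidean inner product of the underlying real space of dimension [2 * n]. *)
Definition rdot n (u v : 'cV[C]_n) : R := complex.Re ((u^t* *m v) 0 0).

Lemma sqnorm_ge0 n (v : 'cV[C]_n) : 0 <= sqnorm v.
Proof. by apply: sumr_ge0 => i _; exact: sqr_ge0. Qed.

Lemma rdotvv n (v : 'cV[C]_n) : rdot v v = sqnorm v.
Proof.
rewrite /rdot mxE raddf_sum; apply: eq_bigr => i _.
by rewrite !mxE; exact: Re_conjM.
Qed.

Lemma rdotDr n (u v w : 'cV[C]_n) : rdot u (v + w) = rdot u v + rdot u w.
Proof. by rewrite /rdot mulmxDr mxE raddfD. Qed.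

Lemma rdotNr n (u v : 'cV[C]_n) : rdot u (- v) = - rdot u v.
Proof. by rewrite /rdot mulmxN mxE raddfN. Qed.

Lemma rdotC n (u v : 'cV[C]_n) : rdot u v = rdot v u.
Proof.
have e : u^t* *m v = (v^t* *m u)^t* by rewrite trmx_mul map_mxM trmxCK.
by rewrite /rdot e 2!mxE; case: (_ 0 0).
Qed.

Lemma rdotMr n m (A : 'M[C]_(n, m)) u v : rdot u (A *m v) = rdot (A^t* *m u) v.
Proof. by rewrite /rdot trmx_mul map_mxM trmxCK mulmxA. Qed.

Lemma rdotZr n (t : R) (u v : 'cV[C]_n) : rdot u (t%:C *: v) = t * rdot u v.
Proof. by rewrite /rdot -scalemxAr mxE complex_ReM /= mul0r subr0. Qed.

Lemma sqnormD n (u v : 'cV[C]_n) :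
  sqnorm (u + v) = sqnorm u + 2 * rdot u v + sqnorm v.
Proof.
rewrite -!rdotvv rdotDr [rdot _ u]rdotC [rdot _ v]rdotC !rdotDr (rdotC v u).
by move: (rdot u u) (rdot u v) (rdot v v) => a b c; lra.
Qed.

Lemma sqnormN n (v : 'cV[C]_n) : sqnorm (- v) = sqnorm v.
Proof. by apply: eq_bigr => i _; rewrite mxE normcN. Qed.

Lemma sqnormZ n (t : C) (v : 'cV[C]_n) :
  sqnorm (t *: v) = normc t ^+ 2 * sqnorm v.
Proof.
by rewrite /sqnorm mulr_sumr; apply: eq_bigr => i _; rewrite mxE normcM exprMn.
Qed.

Lemma normc_real (t : R) : normc t%:C ^+ 2 = t ^+ 2.
Proof. by rewrite normc_sq /= expr0n addr0. Qed.

Lemma sqnorm_eq0 n (v : 'cV[C]_n) : sqnorm v = 0 -> v = 0.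
Proof.
move/eqP; rewrite psumr_eq0 => [/allP h|i _]; last exact: sqr_ge0.
apply/matrixP => i j; rewrite ord1 mxE.
have := h i; rewrite mem_index_enum => /(_ isT); rewrite sqrf_eq0 => /eqP.
exact: eq0_normc.
Qed.

Lemma normc_sum (I : Type) (r : seq I) (P : pred I) (F : I -> C) :
  normc (\sum_(i <- r | P i) F i) <= \sum_(i <- r | P i) normc (F i).
Proof.
elim/big_ind2: _ => [|x1 x2 y1 y2 h1 h2|i _]; rewrite ?normc0//.
by apply: le_trans (le_normcD _ _) _; exact: lerD.
Qed.

Lemma normc_le_sqnorm n (v : 'cV[C]_n) i : normc (v i 0) ^+ 2 <= sqnorm v.
Proof.
by rewrite /sqnorm (bigD1 i)//= lerDl; apply: sumr_ge0 => j _; exact: sqr_ge0.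
Qed.

Lemma sqnorm_bounded m n (A : 'M[C]_(m, n)) :
  exists2 k, 0 < k & forall v, sqnorm (A *m v) <= k * sqnorm v.
Proof.
pose k := \sum_i (\sum_j normc (A i j)) ^+ 2.
have k0 : 0 <= k by apply: sumr_ge0 => i _; exact: sqr_ge0.
(* The added [1] makes the constant positive even for [A = 0], so that it can be inverted later. *)
exists (1 + k) => [|v]; first by lra.
apply: (@le_trans _ _ (k * sqnorm v)); last first.
  by rewrite ler_wpM2r ?sqnorm_ge0//; lra.
rewrite mulr_suml; apply: ler_sum => i _.
have s0 : 0 <= \sum_j normc (A i j) by apply: sumr_ge0 => j _; exact: normc_ge0.
rewrite -[sqnorm v]sqr_sqrtr ?sqnorm_ge0// -exprMn.
rewrite lerXn2r ?nnegrE ?normc_ge0 ?mulr_ge0 ?sqrtr_ge0//.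
rewrite mxE; apply: le_trans (normc_sum _ _ _) _.
rewrite mulr_suml; apply: ler_sum => j _.
rewrite normcM ler_wpM2l ?normc_ge0//.
rewrite -(@ler_pXn2r _ 2)// ?nnegrE ?normc_ge0 ?sqrtr_ge0//.
by rewrite sqr_sqrtr ?sqnorm_ge0// normc_le_sqnorm.
Qed.

(** * Contractions and real matrices *)

Definition contractive n (A : 'M[C]_n) := forall v, sqnorm (A *m v) <= sqnorm v.

(** Expanding [0 <= |A A^t* v - v|^2] and bounding [|A A^t* v|^2] by [|A^t* v|^2] leaves
    [|A^t* v|^2 <= |v|^2]. *)
Lemma contractive_adj n (A : 'M[C]_n) : contractive A -> contractive (A^t*).
Proof.
move=> cA v; have h := cA (A^t* *m v).
have := sqnorm_ge0 (A *m (A^t* *m v) - v).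
rewrite sqnormD sqnormN rdotNr rdotC rdotMr rdotvv; move: h.
by move: (sqnorm _) (sqnorm _) (sqnorm _) => a c d; lra.
Qed.

(* No constraint when [b = false]: real and complex scalars are treated at once. *)
Definition real_if (b : bool) m n (A : 'M[C]_(m, n)) := b -> A ^ conjC = A.

Lemma real_if_adj b m n (A : 'M[C]_(m, n)) : real_if b A -> real_if b (A^t*).
Proof. by move=> h /h e; rewrite -map_trmx e -map_trmx e. Qed.

Lemma real_ifM b m n p (A : 'M[C]_(m, n)) (B : 'M[C]_(n, p)) :
  real_if b A -> real_if b B -> real_if b (A *m B).
Proof. by move=> hA hB hb; rewrite map_mxM hA ?hB. Qed.

Lemma real_ifB b m n (A B : 'M[C]_(m, n)) :
  real_if b A -> real_if b B -> real_if b (A - B).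
Proof. by move=> hA hB hb; rewrite map_mxB hA ?hB. Qed.

Lemma real_ifD b m n (A B : 'M[C]_(m, n)) :
  real_if b A -> real_if b B -> real_if b (A + B).
Proof. by move=> hA hB hb; rewrite map_mxD hA ?hB. Qed.

Lemma real_if1 b n : real_if b (1%:M : 'M[C]_n).
Proof. by move=> _; rewrite map_mx1. Qed.

Lemma real_if_delta b m n i j : real_if b (delta_mx i j : 'M[C]_(m, n)).
Proof. by move=> _; rewrite map_delta_mx. Qed.

Lemma real_ifZ b m n (t : R) (A : 'M[C]_(m, n)) :
  real_if b A -> real_if b (t%:C *: A).
Proof.
by move=> hA hb; rewrite map_mxZ hA//; congr (_ *: _); exact: conjc_real.
Qed.

(** * Extreme points of the set of contractions *)

(** Here [q], [a], [d], [p] stand for the squared norms of [v], [A v], [A^t* A v] and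
    [A (v - A^t* A v)]. The bounds on [p] give [a - d <= q - a], which absorbs the cross term.
    Prescribing [t ^+ 2] covers both signs of [t]. *)
Lemma perturbation_bound (t a d q p : R) : t ^+ 2 = 3 ^- 2 -> d <= a -> a <= q ->
  0 <= p <= q - 2 * a + d -> a + 2 * (t * (a - d)) + t ^+ 2 * p <= q.
Proof.
move=> t2 da aq /andP[p0 pq].
have t_le : t <= 3^-1.
  have /eqP : (t - 3^-1) * (t + 3^-1) = 0 by rewrite -subr_sqr t2 exprVn subrr.
  by rewrite mulf_eq0 => /orP[] /eqP; lra.
have := ler_wpM2r (_ : 0 <= a - d) t_le.
by rewrite subr_ge0 t2 expr2 invfM => /(_ da); lra.
Qed.

(* With [P = 1 - A^* A], [<A x, A P x> = |A x|^2 - |A^* A x|^2] lies between [0]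
   and [<x, P x>], as [A^*] is contractive too. *)
Lemma contractive_perturbation n (A : 'M[C]_n) (t : R) : contractive A ->
  t ^+ 2 = 3 ^- 2 -> contractive (A + t%:C *: (A *m (1%:M - A^t* *m A))).
Proof.
move=> cA t2 v.
have cAt := contractive_adj cA.
set w := A^t* *m (A *m v).
have -> : (A + t%:C *: (A *m (1%:M - A^t* *m A))) *m v
    = A *m v + t%:C *: (A *m (v - w)).
  by rewrite mulmxDl -scalemxAl -!mulmxA mulmxBl mul1mx /w !mulmxA.
have d_le : sqnorm w <= sqnorm (A *m v) by exact: cAt.
have e1 : rdot (A *m v) (A *m (v - w)) = sqnorm (A *m v) - sqnorm w.
  by rewrite rdotMr -/w rdotDr rdotNr rdotvv /w -rdotMr rdotvv.
have e2 : rdot v w = sqnorm (A *m v).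
  by rewrite /w rdotMr trmxCK rdotvv.
rewrite sqnormD sqnormZ rdotZr e1 normc_real; apply: perturbation_bound => //.
rewrite sqnorm_ge0; apply: le_trans (cA _) _.
by rewrite sqnormD rdotNr sqnormN e2 mulrN.
Qed.

(** The hypothesis makes the ranges of [A] and [E] orthogonal, so this is Pythagoras. *)
Lemma sqnormD_orth m n (A E : 'M[C]_(m, n)) v :
  A^t* *m E = 0 -> sqnorm ((A + E) *m v) = sqnorm (A *m v) + sqnorm (E *m v).
Proof.
move=> h; rewrite mulmxDl sqnormD rdotC rdotMr mulmxA h mul0mx.
by rewrite rdotC /rdot mulmx0 mxE mulr0 addr0.
Qed.

(** Tested on matrix units, [Q X P = 0] becomes the vanishing of every product of an entry of [Q]
    and an entry of [P]. *)
Lemma mulmx_delta_entry n (A B : 'M[C]_n) k i j l :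
  (A *m delta_mx i j *m B) k l = A k i * B j l.
Proof.
rewrite -(mul_delta_mx (0 : 'I_1)) mulmxA -colE -mulmxA -rowE.
by rewrite mxE big_ord1 !mxE.
Qed.

(** A first perturbation shows that [A] is a partial isometry, [P] and [Q] projecting onto the
    kernels of [A] and [A^t*]; maps from one kernel to the other supply the remaining
    perturbations. *)
Lemma extreme_unitary b n (A : 'M[C]_n) : contractive A -> real_if b A ->
  (forall E, real_if b E -> contractive (A + E) -> contractive (A - E) ->
     E = 0) ->
  A \is unitarymx.
Proof.
move=> cA rA ext.
set P := 1%:M - A^t* *m A.
set Q := 1%:M - A *m A^t* .
have adj1 : (1%:M : 'M[C]_n)^t* = 1%:M by rewrite trmx1 map_mx1.
have rP : real_if b P.
  by apply: real_ifB; [exact: real_if1|apply: real_ifM => //; exact: real_if_adj].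
have rQ : real_if b Q.
  by apply: real_ifB; [exact: real_if1|apply: real_ifM => //; exact: real_if_adj].
have AP0 : A *m P = 0.
  have e : (3^-1)%:C *: (A *m P) = 0 :> 'M[C]_n.
    apply: ext; first by apply: real_ifZ; exact: real_ifM.
      by apply: contractive_perturbation; rewrite // exprVn.
    rewrite -scaleNr -rmorphN.
    by apply: contractive_perturbation; rewrite // sqrrN exprVn.
  move/eqP: e; rewrite scaler_eq0 => /orP[|/eqP//].
  by rewrite fmorph_eq0 invr_eq0 pnatr_eq0.
have Padj : P^t* = P.
  by rewrite /P linearB/= map_mxB adj1 trmx_mul map_mxM trmxCK.
have PA0 : P *m A^t* = 0.
  by rewrite -{1}Padj -map_mxM -trmx_mul AP0 trmx0 map_mx0.
(* Both [A^t* Q] and [P A^t*] equal [A^t* - A^t* A A^t*]. *)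
have AQ0 : A^t* *m Q = 0.
  by rewrite /Q mulmxBr mulmx1 mulmxA -{1}[A^t*]mul1mx -mulmxBl.
have PP : P *m P = P.
  by rewrite {2}/P mulmxBr mulmx1 mulmxA PA0 mul0mx subr0.
(* As [P] is a self-adjoint idempotent, [|P v|^2 = <v, P v>]. *)
have sqP v : sqnorm (P *m v) = sqnorm v - sqnorm (A *m v).
  rewrite -rdotvv rdotMr Padj mulmxA PP rdotC.
  by rewrite /P mulmxBl mul1mx rdotDr rdotNr rdotvv -mulmxA rdotMr trmxCK rdotvv.
have QP0 i j : Q *m delta_mx i j *m P = 0.
  have [k k0 hk] := sqnorm_bounded (Q *m delta_mx i j).
  have c_gt0 : 0 < sqrtr k^-1 by rewrite sqrtr_gt0 invr_gt0.
  have c2 : sqrtr k^-1 ^+ 2 = k^-1 by rewrite sqr_sqrtr// invr_ge0 ltW.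
  move: (sqrtr k^-1) c_gt0 c2 => c c_gt0 c2.
  (* The perturbation is orthogonal to [A v] and its squared norm is at most [|P v|^2], exactly the
     room [|v|^2 - |A v|^2] left by [A]. *)
  have contr (s : R) : s ^+ 2 = k^-1 ->
      contractive (A + s%:C *: (Q *m delta_mx i j *m P)).
    move=> s2 v; rewrite sqnormD_orth; last first.
      by rewrite -scalemxAr !mulmxA AQ0 !mul0mx scaler0.
    rewrite -scalemxAl sqnormZ normc_real s2 -(mulmxA _ P v) -lerBrDl -sqP.
    by rewrite ler_pdivrMl; [exact: hk|].
  have e : c%:C *: (Q *m delta_mx i j *m P) = 0.
    apply: ext.
    - apply: real_ifZ; apply: real_ifM => //; apply: real_ifM => //.
      exact: real_if_delta.
    - exact: contr.
    - by rewrite -scaleNr -rmorphN; apply: contr; rewrite sqrrN.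
  move/eqP: e; rewrite scaler_eq0 => /orP[|/eqP//].
  by move=> /eqP[c0]; exfalso; rewrite c0 ltxx in c_gt0.
have QP00 k i j l : Q k i * P j l = 0.
  by rewrite -mulmx_delta_entry QP0 [LHS]mxE.
(* If [Q = 0] then [A A^t* = 1]; otherwise a nonzero entry of [Q] kills every entry of [P]. *)
have [Q0|/eqP/matrixP Q0] := eqVneq Q 0.
  by apply/unitarymxP/esym/eqP; rewrite -subr_eq0 -/Q Q0.
have P0 : P = 0.
  apply/matrixP => j l; rewrite [RHS]mxE; apply/eqP/negPn/negP => Pjl.
  apply: Q0 => k i; rewrite [RHS]mxE.
  by move/eqP: (QP00 k i j l); rewrite mulf_eq0 (negbTE Pjl) orbF => /eqP.
apply/unitarymxP; apply: mulmx1C; apply/esym/eqP.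
by rewrite -subr_eq0 -/P P0.
Qed.

End Norm.

(** * Compactness and continuity of complex-valued functions *)

Section Compactness.
Context {R : realType} {T : topologicalType}.
Local Notation C := R[i].

Lemma continuous_bigsum (I : Type) (r : seq I) (P : pred I) (F : I -> T -> R) :
  (forall i, continuous (F i)) -> continuous (fun t => \sum_(i <- r | P i) F i t).
Proof.
move=> cF; elim: r => [|i r IHr].
  by under eq_fun do rewrite big_nil; exact: cst_continuous.
under eq_fun do rewrite big_cons.
by case: (P i) => // t; apply: cvgD; [exact: cF|exact: IHr].
Qed.

Lemma closed_le_continuous (f g : T -> R) :
  continuous f -> continuous g -> closed [set t | f t <= g t].
Proof.
move=> cf cg.
rewrite (_ : [set t | _] = (fun t => f t - g t) @^-1` [set x | x <= 0]).
  apply: preimage_closed; last exact: closed_le.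
  by move=> t _; apply: cvgB; [exact: cf|exact: cg].
by apply/seteqP; split=> t /=; rewrite subr_le0.
Qed.

(** The maximizers of [f] form a closed, hence compact, part of [K], on which [g] attains its
    maximum. *)
Lemma compact_lexmax (K : set T) (f g : T -> R) : compact K -> K !=set0 ->
  continuous f -> continuous g ->
  exists t, [/\ K t, forall s, K s -> f s <= f t &
    forall s, K s -> f s = f t -> g s <= g t].
Proof.
move=> cK K0 cf cg.
have [u /set_mem Ku umax] := compact_EVT_max K0 cK (continuous_subspaceT cf).
pose L := K `&` [set t | f u <= f t].
have cL : compact L.
  apply: compact_closedI => //; apply: closed_le_continuous => //.
  exact: cst_continuous.
have L0 : L !=set0 by exists u; split=> /=.
have [v /set_mem [Kv fv] vmax] := compact_EVT_max L0 cL (continuous_subspaceT cg).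
have fuv : f v = f u by apply/le_anti; rewrite fv umax// mem_set.
exists v; split=> // s Ks => [|fs]; first by rewrite fuv umax// mem_set.
by apply: vmax; rewrite mem_set//; split=> //=; rewrite fs fuv.
Qed.

(** Stated by real and imaginary parts to match the real coordinates in which pairs are
    parametrized. *)
Definition ccontinuous (g : T -> C) :=
  continuous (fun t => complex.Re (g t)) /\ continuous (fun t => complex.Im (g t)).

Lemma ccontinuous_cst (z : C) : ccontinuous (fun=> z).
Proof. by split; exact: cst_continuous. Qed.

Lemma ccontinuousM (g h : T -> C) :
  ccontinuous g -> ccontinuous h -> ccontinuous (fun t => g t * h t).
Proof.
move=> [g1 g2] [h1 h2]; split.
  under eq_fun do rewrite complex_ReM.
  move=> t; apply: cvgB; apply: cvgM;
    by [exact: g1|exact: g2|exact: h1|exact: h2].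
under eq_fun do rewrite complex_ImM.
move=> t; apply: cvgD; apply: cvgM;
  by [exact: g1|exact: g2|exact: h1|exact: h2].
Qed.

Lemma ccontinuous_sum (I : Type) (r : seq I) (P : pred I) (F : I -> T -> C) :
  (forall i, ccontinuous (F i)) ->
  ccontinuous (fun t => \sum_(i <- r | P i) F i t).
Proof.
move=> cF; split.
  under eq_fun do rewrite raddf_sum; apply: continuous_bigsum => i.
  by case: (cF i).
under eq_fun do rewrite raddf_sum; apply: continuous_bigsum => i.
by case: (cF i).
Qed.

Lemma continuous_normc2 (g : T -> C) :
  ccontinuous g -> continuous (fun t => normc (g t) ^+ 2).
Proof.
move=> [g1 g2]; under eq_fun do rewrite normc_sq !expr2.
by move=> t; apply: cvgD; apply: cvgM; by [exact: g1|exact: g2].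
Qed.

Lemma continuous_absIm (g : T -> C) :
  ccontinuous g -> continuous (fun t => `|complex.Im (g t)|).
Proof.
move=> [_]; set h := (fun t => _) => ch t.
exact: (@continuous_comp _ _ _ h (@normr _ R) t (ch t) (@norm_continuous _ R _)).
Qed.

Lemma ccontinuous_mulmx m n p (A : T -> 'M[C]_(m, n)) (B : T -> 'M[C]_(n, p)) :
  (forall i j, ccontinuous (fun t => A t i j)) ->
  (forall i j, ccontinuous (fun t => B t i j)) ->
  forall i j, ccontinuous (fun t => (A t *m B t) i j).
Proof.
move=> cA cB i j; under eq_fun do rewrite mxE.
by apply: ccontinuous_sum => k; exact: ccontinuousM.
Qed.

Lemma continuous_sqnorm n (v : T -> 'cV[C]_n) :
  (forall i j, ccontinuous (fun t => v t i j)) ->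
  continuous (fun t => sqnorm (v t)).
Proof.
by move=> cv; apply: continuous_bigsum => i; exact: continuous_normc2.
Qed.

End Compactness.

(** * Lexicographic maximization over contractions and unit-ball vectors *)

Section Maximizer.
Context {R : realType}.
Local Notation C := R[i].

(** The squared Frobenius norm, by columns so that vector identities apply termwise. *)
Definition frobenius n (A : 'M[C]_n) : R := \sum_i sqnorm (col i A).

Definition feasible b n (A : 'M[C]_n) (x : 'cV[C]_n) :=
  [/\ contractive A, sqnorm x <= 1, real_if b A & real_if b x].

(** Inequalities between continuous functions make the real condition visibly closed. *)
Lemma real_ifP b m n (A : 'M[C]_(m, n)) :
  real_if b A <-> (forall i j, b -> `|complex.Im (A i j)| <= 0).
Proof.
split=> [h i j /h /matrixP/(_ i j)|h hb].
  rewrite mxE => e; rewrite normr_le0; apply/eqP; move: e.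
  by case: (A i j) => x y /= [] ?; lra.
apply/matrixP => i j; rewrite mxE; have := h i j hb.
by rewrite normr_le0; case: (A i j) => x y /= /eqP ->; congr Complex; rewrite oppr0.
Qed.

Lemma feasible_entries b n (A : 'M[C]_n) x : feasible b A x ->
  (forall i j, normc (A i j) <= 1) /\ (forall i, normc (x i 0) <= 1).
Proof.
have le1 m (v : 'cV[C]_m) i : sqnorm v <= 1 -> normc (v i 0) <= 1.
  move=> /(le_trans (normc_le_sqnorm v i)); rewrite -{1}[1](expr1n _ 2).
  by rewrite ler_pXn2r ?nnegrE ?normc_ge0.
move=> [cA x1 _ _]; split=> [i j|i]; last exact: le1.
have -> : A i j = (A *m delta_mx j 0 : 'cV_n) i 0 by rewrite -colE mxE.
apply: le1; apply: le_trans (cA _) _.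
rewrite /sqnorm (bigD1 j)//= big1 => [|k kj].
  by rewrite mxE !eqxx normc1 expr1n addr0.
by rewrite mxE (negbTE kj) normc0 expr0n.
Qed.

(** Feasible pairs form a closed part of a cube of real coordinates, compact by Tychonoff.
    Continuity is asked along every continuous family of pairs, so no topology on matrices is
    fixed. *)
Lemma feasible_lexmax b n (f g : 'M[C]_n -> 'cV[C]_n -> R) :
  (forall (T : topologicalType) (A : T -> 'M[C]_n) (x : T -> 'cV[C]_n),
     (forall i j, ccontinuous (fun t => A t i j)) ->
     (forall i j, ccontinuous (fun t => x t i j)) ->
     continuous (fun t => f (A t) (x t)) /\ continuous (fun t => g (A t) (x t))) ->
  exists A x, [/\ feasible b A x,
    forall B y, feasible b B y -> f B y <= f A x &
    forall B y, feasible b B y -> f B y = f A x -> g B y <= g A x].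
Proof.
move=> cfg.
(* Coordinates of a pair: real (false) or imaginary (true) part of the entry
   [(i, Some j)] of the matrix or [(i, None)] of the vector. *)
pose J := (bool * ('I_n * option 'I_n))%type.
pose T : topologicalType := prod_topology (fun _ : J => R : topologicalType).
pose z (t : T) i o : C := Complex (t (false, (i, o))) (t (true, (i, o))).
pose A t : 'M[C]_n := \matrix_(i, j) z t i (Some j).
pose x t : 'cV[C]_n := \col_i z t i None.
have cz i o : ccontinuous (fun t => z t i o) by split; exact: proj_continuous.
have cA i j : ccontinuous (fun t => A t i j) by under eq_fun do rewrite mxE.
have cx i j : ccontinuous (fun t => x t i j) by under eq_fun do rewrite mxE.
have [cf cg] := cfg T A x cA cx.
have onto B y : exists t, A t = B /\ x t = y.
  exists (fun k : J => let w := if k.2.2 is Some j then B k.2.1 j else y k.2.1 0 in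
    if k.1 then complex.Im w else complex.Re w).
  by split; apply/matrixP => i j; rewrite !mxE /z /= ?ord1; case: (_ i _).
pose box : set T := [set t | forall k, `[-1, 1]%classic (t k)].
have cbox : compact box.
  exact: (@tychonoff J (fun=> R : topologicalType) (fun=> `[-1, 1]%classic)
    (fun=> @segment_compact R (-1) 1)).
pose K := box `&` [set t | feasible b (A t) (x t)].
have cK : compact K.
  apply: compact_closedI => //.
  (* The index set [[set _ : unit | b]] is empty when [b] fails, which encodes the implication as an
     intersection. *)
  have -> : [set t | feasible b (A t) (x t)] =
      (\bigcap_v [set t | sqnorm (A t *m v) <= sqnorm v]) `&`
      [set t | sqnorm (x t) <= 1] `&`
      (\bigcap_(i in [set: 'I_n]) \bigcap_(j in [set: 'I_n])
         \bigcap_(_ in [set _ : unit | b]) [set t | `|complex.Im (A t i j)| <= 0]) `&`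
      (\bigcap_(i in [set: 'I_n]) \bigcap_(j in [set: 'I_1])
         \bigcap_(_ in [set _ : unit | b]) [set t | `|complex.Im (x t i j)| <= 0]).
    apply/seteqP; split=> t /=.
      move=> [h1 h2 /real_ifP h3 /real_ifP h4]; split; [split; [split|]|] => //.
      - by move=> v _; exact: h1.
      - by move=> i _ j _ ? hb; exact: h3.
      - by move=> i _ j _ ? hb; exact: h4.
    move=> [[[h1 h2] h3] h4]; split=> //.
    - by move=> v; exact: h1.
    - by apply/real_ifP => i j ?; exact: (h3 i I j I tt).
    - by apply/real_ifP => i j ?; exact: (h4 i I j I tt).
  have c0 : continuous (fun _ : T => 0 : R) by exact: cst_continuous.
  apply: closedI; [apply: closedI; [apply: closedI|]|].
  - apply: closed_bigI => v _.
    apply: closed_le_continuous; last exact: cst_continuous.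
    apply: continuous_sqnorm; apply: ccontinuous_mulmx => // i j.
    exact: ccontinuous_cst.
  - apply: closed_le_continuous; last exact: cst_continuous.
    exact: continuous_sqnorm.
  - do 3![apply: closed_bigI => ? _]; apply: closed_le_continuous => //.
    exact: continuous_absIm.
  - do 3![apply: closed_bigI => ? _]; apply: closed_le_continuous => //.
    exact: continuous_absIm.
(* Feasibility already bounds all coordinates by [1], so the box excludes no feasible pair. *)
have K_feasible t : K t <-> feasible b (A t) (x t).
  split=> [[]//|h]; split=> // -[c [i o]]; have [hA hx] := feasible_entries h.
  have z1 : normc (z t i o) <= 1.
    by case: o => [j|]; [have := hA i j|have := hx i]; rewrite mxE.
  have : normc (z t i o) ^+ 2 <= 1.
    by rewrite expr_le1// normc_ge0.
  rewrite normc_sq /= in_itv/= -ler_norml => h1.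
  by rewrite -(@expr_le1 _ 2)// real_normK ?num_real//; case: c;
    apply: le_trans h1; rewrite ?lerDl ?lerDr sqr_ge0.
have K0 : K !=set0.
  have [t [At xt]] := onto 0 0; exists t; apply/K_feasible; rewrite At xt.
  have s0 : sqnorm (0 : 'cV[C]_n) = 0.
    by apply: big1 => i _; rewrite mxE normc0 expr0n.
  split=> [v|||]; rewrite ?mul0mx ?s0 ?sqnorm_ge0//.
  - by move=> _; rewrite map_mx0.
  - by move=> _; rewrite map_mx0.
have [t [Kt tf tg]] := compact_lexmax cK K0 cf cg.
exists (A t), (x t); split; first exact/K_feasible.
  by move=> B y; have [s [<- <-]] := onto B y => /K_feasible; exact: tf.
by move=> B y; have [s [<- <-]] := onto B y => /K_feasible; exact: tg.
Qed.

End Maximizer.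

(** * Unitarity of the maximizers *)

Section UnitaryMaximizer.
Context {R : realType}.
Local Notation C := R[i].

Lemma sqnorm_parallelogram n (u v : 'cV[C]_n) :
  sqnorm (u + v) + sqnorm (u - v) = 2 * (sqnorm u + sqnorm v).
Proof.
rewrite !sqnormD sqnormN rdotNr.
by move: (sqnorm u) (sqnorm v) (rdot u v) => a b c; ring.
Qed.

Lemma schur_productD n (M A B : 'M[C]_n) :
  schur_product M (A + B) = schur_product M A + schur_product M B.
Proof. by apply/matrixP => i j; rewrite !mxE mulrDr. Qed.

Lemma schur_productN n (M A : 'M[C]_n) :
  schur_product M (- A) = - schur_product M A.
Proof. by apply/matrixP => i j; rewrite !mxE mulrN. Qed.

Lemma frobenius_parallelogram n (A B : 'M[C]_n) :
  frobenius (A + B) + frobenius (A - B) = 2 * (frobenius A + frobenius B).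
Proof.
rewrite /frobenius -!big_split/= mulr_sumr; apply: eq_bigr => i _.
by rewrite !linearD linearN/= sqnorm_parallelogram.
Qed.

Lemma frobenius_le0 n (A : 'M[C]_n) : frobenius A <= 0 -> A = 0.
Proof.
move=> A0; have /eqP : frobenius A = 0.
  by apply/le_anti; rewrite A0 sumr_ge0// => i _; exact: sqnorm_ge0.
rewrite psumr_eq0 => [/allP h|i _]; last exact: sqnorm_ge0.
apply/matrixP => i j; have := h j; rewrite mem_index_enum => /(_ isT) /eqP.
by move/sqnorm_eq0/matrixP/(_ i 0); rewrite !mxE.
Qed.

(** Two numbers bounded by [m] cannot average to more than [m]. It serves first for the value, then
    for the Frobenius norm. *)
Lemma real_midpoint_max (a b m c : R) :
  a + b = 2 * (m + c) -> 0 <= c -> a <= m -> b <= m -> [/\ a = m, b = m & c <= 0].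
Proof. by move=> h c0 am bm; split; lra. Qed.

(* Among the maximizers of a convex function, those of largest Frobenius norm
   are extreme points of the unit ball. *)
Lemma unitary_maximizer b n (M : 'M[C]_n) : exists U x,
  [/\ U \is unitarymx, feasible b U x & forall B y, feasible b B y ->
    sqnorm (schur_product M B *m y) <= sqnorm (schur_product M U *m x)].
Proof.
have [|U [x [[cU x1 rU rx] maxf maxg]]] := @feasible_lexmax R b n
    (fun A x => sqnorm (schur_product M A *m x)) (fun A _ => frobenius A).
  move=> T A x cA cx; split.
    apply: continuous_sqnorm; apply: ccontinuous_mulmx => // i j.
    under eq_fun do rewrite mxE; apply: ccontinuousM => //.
    exact: ccontinuous_cst.
  apply: continuous_bigsum => i; apply: continuous_sqnorm => k j.
  by under eq_fun do rewrite mxE.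
exists U, x; split=> //; apply: (extreme_unitary cU rU) => E rE cD cB.
have fD : feasible b (U + E) x by split=> //; exact: real_ifD.
have fB : feasible b (U - E) x by split=> //; exact: real_ifB.
have e : sqnorm (schur_product M (U + E) *m x)
    + sqnorm (schur_product M (U - E) *m x)
    = 2 * (sqnorm (schur_product M U *m x) + sqnorm (schur_product M E *m x)).
  by rewrite !schur_productD schur_productN !mulmxDl mulNmx sqnorm_parallelogram.
(* Both perturbed pairs are again maximizers, so the Frobenius comparison applies to them. *)
have [eD eB _] := real_midpoint_max e (sqnorm_ge0 _) (maxf _ _ fD) (maxf _ _ fB).
have E0 : 0 <= frobenius E by apply: sumr_ge0 => i _; exact: sqnorm_ge0.
have [_ _] := real_midpoint_max (frobenius_parallelogram U E) E0
  (maxg _ _ fD eD) (maxg _ _ fB eB).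
exact: frobenius_le0.
Qed.

(** * Reduction from complex to real pairs *)

(** The unimodular factor rotating [z] onto the nonnegative reals; the value [1] at [0] keeps it
    invertible. *)
Definition phase (z : C) : C := if z == 0 then 1 else (normc z)%:C / z.

Lemma phaseM z : phase z * z = (normc z)%:C.
Proof.
rewrite /phase; have [->|z0] := eqVneq z 0; last by rewrite divfK.
by rewrite mulr0 normc0.
Qed.

Lemma normc_phase z : normc (phase z) = 1.
Proof.
rewrite /phase; have [_|z0] := eqVneq z 0; first exact: normc1.
have nz : normc z != 0 by apply: contra_neq z0; exact: eq0_normc.
by rewrite normcM normcV /= expr0n addr0 sqrtr_sqr ger0_norm ?normc_ge0// divff.
Qed.

Lemma phase_neq0 z : phase z != 0.
Proof.
apply/eqP => h; have := normc_phase z; rewrite h normc0 => /eqP.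
by rewrite eq_sym oner_eq0.
Qed.

Lemma sqnorm_phase n (z : 'I_n -> C) (v : 'cV[C]_n) :
  sqnorm (\col_i (phase (z i) * v i 0)) = sqnorm v.
Proof. by apply: eq_bigr => i _; rewrite mxE normcM normc_phase mul1r. Qed.

Lemma sqnorm_phaseV n (z : 'I_n -> C) (v : 'cV[C]_n) :
  sqnorm (\col_i ((phase (z i))^-1 * v i 0)) = sqnorm v.
Proof.
by apply: eq_bigr => i _; rewrite mxE normcM normcV normc_phase invr1 mul1r.
Qed.

(** The matrix is [A] between two unimodular diagonal matrices, which preserve [sqnorm]. *)
Lemma contractive_phase n (y z : 'I_n -> C) (A : 'M[C]_n) : contractive A ->
  contractive (\matrix_(i, j) (phase (y i) * A i j * (phase (z j))^-1)).
Proof.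
move=> cA v; rewrite -(sqnorm_phaseV z v); apply: le_trans (cA _).
rewrite -(sqnorm_phase y (A *m _)) le_eqVlt; apply/orP; left; apply/eqP.
congr sqnorm; apply/matrixP => i k; rewrite !mxE mulr_sumr ord1.
by apply: eq_bigr => j _; rewrite !mxE !mulrA.
Qed.

Lemma Re_realM (r s : R) (z : C) :
  (complex.Re (r%:C * z * s%:C))%:C = r%:C * (complex.Re z)%:C * s%:C.
Proof. by rewrite -!rmorphM !complex_ReM /= mul0r mulr0 !subr0. Qed.

Definition real_part n (A : 'M[C]_n) : 'M[C]_n :=
  map_mx (fun z => (complex.Re z)%:C) A.

Lemma sqnorm_conj n (v : 'cV[C]_n) : sqnorm (map_mx conjC v) = sqnorm v.
Proof.
apply: eq_bigr => i _; rewrite mxE !normc_sq.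
by case: (v i 0) => a b /=; rewrite sqrrN.
Qed.

(** The real part averages [A] and its conjugate, both contractions, and the parallelogram law
    bounds the average. *)
Lemma contractive_real_part n (A : 'M[C]_n) :
  contractive A -> contractive (real_part A).
Proof.
move=> cA v.
have -> : real_part A = (2^-1)%:C *: (A + map_mx conjC A).
  apply/matrixP => i j; rewrite !mxE ReJ_add mulrC; congr (_ * _).
  by rewrite fmorphV rmorph_nat.
have cAv : sqnorm (map_mx conjC A *m v) <= sqnorm v.
  have vK : map_mx conjC (map_mx conjC v) = v.
    by apply/matrixP => i j; rewrite !mxE conjCK.
  rewrite -[in leLHS]vK -map_mxM sqnorm_conj.
  by apply: le_trans (cA _) _; rewrite sqnorm_conj.
rewrite -scalemxAl mulmxDl sqnormZ normc_real exprVn ler_pdivrMl ?exprn_gt0//.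
have := sqnorm_parallelogram (A *m v) (map_mx conjC A *m v).
have := sqnorm_ge0 (A *m v - map_mx conjC A *m v); move: (cA v) cAv.
move: (sqnorm (A *m v)) (sqnorm (map_mx conjC A *m v)) (sqnorm v)
  (sqnorm (A *m v + _)) (sqnorm (A *m v - _)) => p q r s t.
by clear; rewrite expr2; lra.
Qed.

(* Unimodular diagonal factors make [x] and [(M o A) x] nonnegative; for real
   [M] the value then depends only on the real part of [A]. *)
Lemma real_feasible n (M : 'M[R]_n) A x : feasible false A x ->
  exists B y, feasible true B y /\
    sqnorm (schur_product (complex_mx M) B *m y) =
    sqnorm (schur_product (complex_mx M) A *m x).
Proof.
move=> [cA x1 _ _].
have [a aE] : exists a, a = schur_product (complex_mx M) A *m x by eexists.
rewrite -aE.
pose A1 := \matrix_(i, j) (phase (a i 0) * A i j * (phase (x j 0))^-1).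
pose y : 'cV[C]_n := \col_j (normc (x j 0))%:C.
have normc_normc (z : C) : normc (normc z)%:C ^+ 2 = normc z ^+ 2.
  exact: normc_real.
exists (real_part A1), y; split.
  split.
  - exact/contractive_real_part/contractive_phase.
  - by rewrite /sqnorm; under eq_bigr do rewrite mxE normc_normc.
  - by move=> _; apply/matrixP => i j; rewrite !mxE; exact: conjc_real.
  - by move=> _; apply/matrixP => i j; rewrite !mxE; exact: conjc_real.
apply: eq_bigr => i _; rewrite -[RHS]normc_normc -phaseM; congr (normc _ ^+ 2).
(* Being real, this number equals its real part, which is then taken term by term: [M i j] and
   [y j 0] are real, so it falls on [A1 i j]. *)
have -> : phase (a i 0) * a i 0 = (complex.Re (phase (a i 0) * a i 0))%:C.
  by rewrite phaseM.
rewrite {2}aE !mxE mulr_sumr !raddf_sum/=; apply: eq_bigr => j _.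
rewrite !mxE /= -Re_realM; congr (complex.Re _)%:C.
rewrite -phaseM !mulrA mulfVK ?phase_neq0//.
by rewrite [phase _ * (M i j)%:C]mulrC.
Qed.

End UnitaryMaximizer.

(** * The operator norm in terms of squared norms *)

Section OperatorNorm.
Context {R : realType}.
Local Notation C := R[i].

Lemma euclidean_norm_le1 n (v : 'cV[C]_n) :
  (euclidean_norm v <= 1) = (sqnorm v <= 1).
Proof. by rewrite -{1}sqrtr1 ler_sqrt. Qed.

Lemma operator_norm_le n (A : 'M[C]_n) (s : R) :
  (forall v, sqnorm v <= 1 -> sqnorm (A *m v) <= s) ->
  operator_norm A <= sqrtr s.
Proof.
move=> h; apply: ge_sup => [|_ [v + ->]].
  (* Bounding [sup] requires a nonempty set; [v = 0] provides an element. *)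
  exists (euclidean_norm (A *m 0)), 0 => //.
  rewrite euclidean_norm_le1 /sqnorm big1// => i _.
  by rewrite mxE normc0 expr0n.
by rewrite euclidean_norm_le1 => /h; exact: ler_wsqrtr.
Qed.

Lemma operator_norm_ge n (A : 'M[C]_n) v :
  sqnorm v <= 1 -> sqrtr (sqnorm (A *m v)) <= operator_norm A.
Proof.
move=> v1; apply: ub_le_sup; last by exists v => //; rewrite euclidean_norm_le1.
(* [sup] is known to dominate its elements once the set is bounded above. *)
have [k k0 hk] := sqnorm_bounded A.
exists (sqrtr k) => _ [w + ->]; rewrite euclidean_norm_le1 => w1.
apply: ler_wsqrtr; apply: le_trans (hk w) _.
by rewrite -[leRHS]mulr1 ler_pM2l.
Qed.

Lemma operator_norm_le1 n (A : 'M[C]_n) :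
  operator_norm A <= 1 <-> contractive A.
Proof.
split=> [A1 v|cA]; last first.
  by rewrite -[leRHS]sqrtr1; apply: operator_norm_le => v; exact: le_trans.
have [/sqnorm_eq0 ->|v0] := eqVneq (sqnorm v) 0.
  by rewrite mulmx0.
have v_gt0 : 0 < sqnorm v by rewrite lt_neqAle eq_sym v0 sqnorm_ge0.
(* Scaling by [c] brings [v] to norm [1]. *)
pose c := sqrtr (sqnorm v)^-1.
have c2 : c ^+ 2 = (sqnorm v)^-1 by rewrite sqr_sqrtr// invr_ge0 ltW.
have w1 : sqnorm (c%:C *: v) <= 1 by rewrite sqnormZ normc_real c2 mulVf.
have := le_trans (operator_norm_ge A w1) A1.
rewrite -{1}sqrtr1 ler_sqrt// -scalemxAr sqnormZ normc_real c2.
by rewrite ler_pdivrMl// mulr1.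
Qed.

Lemma unitary_isometry n (U : 'M[C]_n) v :
  U \is unitarymx -> sqnorm (U *m v) = sqnorm v.
Proof.
move=> /unitarymxP/mulmx1C UU.
by rewrite -rdotvv rdotMr mulmxA UU mul1mx rdotvv.
Qed.

Lemma operator_norm_unitary n (U : 'M[C]_n) : (0 < n)%N ->
  U \is unitarymx -> operator_norm U = 1.
Proof.
case: n U => // n U _ uU; apply/le_anti/andP; split.
  by apply/operator_norm_le1 => v; rewrite unitary_isometry.
have e1 : sqnorm (delta_mx 0 0 : 'cV[C]_n.+1) = 1.
  rewrite /sqnorm (bigD1 0)//= big1 => [|k k0].
    by rewrite mxE !eqxx normc1 expr1n addr0.
  by rewrite mxE (negbTE k0) normc0 expr0n.
have := @operator_norm_ge _ U (delta_mx 0 0).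
by rewrite unitary_isometry// e1 sqrtr1; exact.
Qed.

(** * Witnesses for the Schur norm *)

(** As [U] has norm exactly [1], its value lies in [schur_values M]; maximality makes it the
    greatest element, and uniqueness of the latter determines [xget]. *)
Lemma unitary_witness n (M U : 'M[C]_n) x : (0 < n)%N ->
  U \is unitarymx -> sqnorm x <= 1 ->
  (forall B y, feasible false B y ->
    sqnorm (schur_product M B *m y) <= sqnorm (schur_product M U *m x)) ->
  schur_witness M U.
Proof.
move=> n0 uU x1 maxU; have U1 := operator_norm_unitary n0 uU.
split; first by rewrite U1.
apply/esym/xget_subset1.
  split; first by exists U.
  move=> _ [B B1 ->]; apply: le_trans (operator_norm_ge _ x1).
  apply: operator_norm_le => y y1; apply: maxU; split=> //.
  by apply/operator_norm_le1; rewrite B1.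
by move=> r s [rv rub] [sv sub]; apply/le_anti; rewrite rub// sub.
Qed.

Lemma orthogonal_witness n (M : 'M[R]_n) : (0 < n)%N ->
  exists Q : 'M[R]_n,
    orthogonal_mx Q /\ schur_witness (complex_mx M) (complex_mx Q).
Proof.
move=> n0; have [U [x [uU [_ x1 rU _] maxU]]] :=
  unitary_maximizer true (complex_mx M).
have conjU := rU isT.
exists (map_mx (@complex.Re R) U).
have UE : complex_mx (map_mx (@complex.Re R) U) = U.
  apply/matrixP => i j; rewrite !mxE; move/matrixP/(_ i j): conjU; rewrite mxE.
  by case: (U i j) => a b /= [] h; congr Complex; lra.
split.
  apply: (@map_mx_inj _ _ (real_complex R)).
  rewrite map_mx1 map_mxM -map_trmx -/(complex_mx _) UE.
  move/unitarymxP: uU; rewrite -map_trmx conjU; exact.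
rewrite UE; apply: (unitary_witness n0 uU x1) => B y fB.
(* Each complex pair has the value of some real pair, so the real maximizer also dominates all
   complex pairs. *)
have [B' [y' [fB' <-]]] := real_feasible M fB.
exact: maxU.
Qed.

End OperatorNorm.

Theorem theorem1 (R : realType) (n : nat) (n_gt0 : (0 < n)%N) :
  (forall M : 'M[R]_n, exists C : 'M[R]_n,
     schur_witness (complex_mx M) (complex_mx C)) /\
  (forall M : 'M[R]_n, exists C : 'M[R]_n,
     orthogonal_mx C /\ schur_witness (complex_mx M) (complex_mx C)) /\
  (forall M : 'M[complex R]_n, exists C : 'M[complex R]_n,
     C \is unitarymx /\ schur_witness M C).
Proof.
split; [|split] => M.
- by have [Q [_ wQ]] := orthogonal_witness M n_gt0; exists Q.
- exact: orthogonal_witness.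
- have [U [x [uU [_ x1 _ _] maxU]]] := unitary_maximizer false M.
  by exists U; split=> //; exact: unitary_witness maxU.
Qed.
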